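(* Let $\mathcal{M}$ be a matroid. Then its basis polytope $\mathcal{P}_B(\mathcal{M})$ has the clique-face property, i.e. every clique of the $1$-skeleton $\mathrm{sk}(\mathcal{P}_B(\mathcal{M}))$ is the vertex set of a face of $\mathcal{P}_B(\mathcal{M})$.
   Context: A matroid $\mathcal{M}=(E,\mathcal{I})$ consists of a finite set $E=\{e_1,\dots,e_n\}$ and $\mathcal{I}\subseteq 2^E$ (the independent sets) such that $\emptyset\in\mathcal{I}$; subsets of members of $\mathcal{I}$ are in $\mathcal{I}$; and if $I_1,I_2\in\mathcal{I}$ with $|I_1|<|I_2|$ then $I_1\cup\{x\}\in\mathcal{I}$ for some $x\in I_2\setminus I_1$. A basis is an independent set of maximum cardinality; $\mathcal{B}$ denotes the set of bases. For $I\subset E$ let $\rho(I)=\sum_{e_i\in I}\mathbf{e}_i\in\{0,1\}^n$, with $\mathbf{e}_i$ the unit coordinate vectors of $\mathbb{R}^n$. The basis polytope is $\mathcal{P}_B(\mathcal{M})=\mathrm{conv}\{\rho(B):B\in\mathcal{B}\}$. The $1$-skeleton $\mathrm{sk}(P)$ of a polytope $P$ is the simple graph on the vertices of $P$ with $v\ne w$ adjacent iff $\mathrm{conv}(\{v,w\})$ is an edge of $P$. A clique is the vertex set of a complete subgraph. $P$ itself is regarded as a face of $P$. *)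

(* Defs.v *)
From HB Require Import structures.
From mathcomp Require Import all_boot all_order all_algebra.
From mathcomp Require Import boolp classical_sets reals.

Set Implicit Arguments.
Unset Strict Implicit.
Unset Printing Implicit Defensive.

Import Order.TTheory GRing.Theory Num.Theory.

Local Open Scope ring_scope.

Record matroid (E : finType) := Matroid {
  indep : {set {set E}};
  indep0 : finset.set0 \in indep;
  indepS : forall I J : {set E}, J \in indep -> I \subset J -> I \in indep;
  indep_augment : forall I1 I2 : {set E},
    I1 \in indep -> I2 \in indep -> (#|I1| < #|I2|)%N ->
    exists2 x, x \in (I2 :\: I1)%SET & (x |: I1)%SET \in indep
}.

Definition bases (E : finType) (M : matroid E) : {set {set E}} :=
  [set B in indep M | [forall (I | I \in indep M), #|I| <= #|B|]%N]%SET.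

Local Open Scope classical_set_scope.

Record sgraph (T : Type) := SGraph {
  gvert : set T;
  gadj : T -> T -> Prop;
  gadj_vert : forall x y, gadj x y -> gvert x /\ gvert y;
  gadj_sym : forall x y, gadj x y -> gadj y x;
  gadj_irrefl : forall x, ~ gadj x x
}.

(* The empty set is a clique. *)
Definition clique (T : Type) (G : sgraph T) (C : set T) : Prop :=
  C `<=` gvert G /\ forall x y, C x -> C y -> x <> y -> gadj G x y.

Section Polytopes.
Variables (R : realType) (n : nat).
Implicit Types (S P F : set 'rV[R]_n) (c v w x : 'rV[R]_n).

Definition dotp c x : R := \sum_(i < n) c 0 i * x 0 i.

Definition conv_hull S : set 'rV[R]_n :=
  [set x | exists (k : nat) (p : 'I_k -> 'rV[R]_n) (a : 'I_k -> R),
     [/\ forall i, S (p i), forall i, 0 <= a i, \sum_i a i = 1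
       & x = \sum_i a i *: p i]].

Definition aff_hull S : set 'rV[R]_n :=
  [set x | exists (k : nat) (p : 'I_k -> 'rV[R]_n) (a : 'I_k -> R),
     [/\ forall i, S (p i), \sum_i a i = 1 & x = \sum_i a i *: p i]].

(* Dimension of the affine hull; the empty set has no dimension here. *)
Definition has_dim S (d : nat) : Prop :=
  exists (x : 'rV[R]_n) (U : {vspace 'rV[R]_n}),
    aff_hull S = [set x + u | u in [set u | u \in U]] /\ \dim U = d.

(* Taking c = 0 shows that P itself (b = 0) and the empty set (b = 1) are
   faces of P. *)
Definition face P F : Prop :=
  exists (c : 'rV[R]_n) (b : R),
    (forall x, P x -> dotp c x <= b) /\ F = P `&` [set x | dotp c x = b].

Definition vertices P : set 'rV[R]_n := [set v | face P [set v]].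

Definition edge P F : Prop := face P F /\ has_dim F 1.

Definition sk_adj P v w : Prop :=
  [/\ vertices P v, vertices P w, v <> w & edge P (conv_hull [set v; w])].

Lemma sk_adj_vert P v w : sk_adj P v w -> vertices P v /\ vertices P w.
Proof. by case. Qed.

Lemma sk_adj_sym P v w : sk_adj P v w -> sk_adj P w v.
Proof. by case=> Pv Pw vw e; split=> //; [exact/nesym | rewrite setUC]. Qed.

Lemma sk_adj_irrefl P v : ~ sk_adj P v v.
Proof. by case. Qed.

Definition sk P : sgraph 'rV[R]_n :=
  SGraph (@sk_adj_vert P) (@sk_adj_sym P) (@sk_adj_irrefl P).

Definition clique_face_property P : Prop :=
  forall C, clique (sk P) C -> exists2 F, face P F & C = vertices F.

End Polytopes.

(* The enumeration of E plays the role of e_1, ..., e_n, with n = #|E|. *)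
Definition rho (R : realType) (E : finType) (I : {set E}) : 'rV[R]_#|E| :=
  \sum_(e in I) delta_mx 0 (enum_rank e).

Definition basis_polytope (R : realType) (E : finType) (M : matroid E) :
    set 'rV[R]_#|E| :=
  conv_hull [set rho R B | B in [set B | B \in bases M]].
Arguments basis_polytope R {E} M.

(* Main.v *)
Require Import Defs.
From mathcomp Require Import all_boot all_order all_algebra.
From mathcomp Require Import boolp classical_sets reals.

(** Let the clique consist of the points [rho A], for [A] in a family [K] of
    bases, and let [r] be the rank of the matroid.  Two facts give the result.

    Adjacent bases [A] and [B] meet in [r - 1] elements
    ([card_basesI_adj]).  Indeed, let [c] be a functional that is maximal
    over the polytope exactly on the segment from [rho A] to [rho B], and let
    [x] minimize [c] on the symmetric difference of [A] and [B]; by symmetry,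
    [x] lies in [A].  A basis exchange replaces [x] in [A] by some [y] in
    [B :\: A] and does not decrease [c], so that the new basis again lies on the
    segment.  It is not [A], hence it is [B].

    The functional [c = \sum_(A in K) rho A] then cuts out the face.  Its value
    at [rho B] is the sum over [A] in [K] of [#|A :&: B|].  If [B] is in [K],
    this is [r + (#|K| - 1) (r - 1) = 1 + #|K| (r - 1)] because the members of
    [K] are pairwise adjacent.  If [B] is not in [K], every term is at most
    [r - 1], so that the value is at most [#|K| (r - 1)].  Hence [c] attains its
    bound [1 + #|K| (r - 1)] exactly at the bases of [K]; when [K] is empty this
    says [0 < 1] and yields the empty face. *)

Set Implicit Arguments.
Unset Strict Implicit.
Unset Printing Implicit Defensive.

Import Order.TTheory GRing.Theory Num.Theory.

Local Open Scope ring_scope.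
Local Open Scope classical_set_scope.

(** * Bases of a matroid *)

Section Bases.
Variables (E : finType) (M : matroid E).
Implicit Types A B : {set E}.

Definition rank : nat := \max_(I in indep M) #|I|.

Lemma basesP B : reflect (B \in indep M /\ #|B| = rank) (B \in bases M).
Proof.
rewrite inE; apply: (iffP andP) => -[Bi].
  move=> /forall_inP Bmax; split=> //; apply/eqP; rewrite eqn_leq.
  rewrite (leq_bigmax_cond (F := fun I : {set E} => #|I|) _ Bi) /=.
  by apply/bigmax_leqP => I; exact: Bmax.
move=> cB; split=> //; apply/forall_inP => I Ii.
by rewrite cB (leq_bigmax_cond (F := fun I : {set E} => #|I|) _ Ii).
Qed.

Lemma card_basis B : B \in bases M -> #|B| = rank.
Proof. by case/basesP. Qed.

Lemma basis_exchange A B x :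
  A \in bases M -> B \in bases M -> x \in (A :\: B)%SET ->
  exists2 y, y \in (B :\: A)%SET & (y |: A :\ x)%SET \in bases M.
Proof.
move=> /basesP[Ai cA] /basesP[Bi cB]; rewrite inE => /andP[xB xA].
have cAx : #|A :\ x|%SET.+1 = rank by rewrite -cA (cardsD1 x A) xA.
have Axi : (A :\ x)%SET \in indep M by apply: indepS Ai _; rewrite subsetDl.
have [|y] := indep_augment Axi Bi; first by rewrite cB -cAx.
rewrite !inE negb_and negbK => /andP[/orP[/eqP->|yA] yB yi].
  by rewrite yB in xB.
exists y; first by rewrite inE yA.
by apply/basesP; split=> //; rewrite cardsU1 !inE negb_and yA orbT.
Qed.

Lemma card_basesI_lt A B : A \in bases M -> B \in bases M -> A != B ->
  (#|A :&: B|%SET < rank)%N.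
Proof.
move=> /card_basis cA /card_basis cB; apply: contraR; rewrite -leqNgt => cAB.
have /eqP AB : (A :&: B)%SET == A by rewrite eqEcard subsetIl cA.
by rewrite eqEcard cA cB leqnn -AB subsetIr.
Qed.

End Bases.

(** * Faces of convex hulls *)

Section Hulls.
Variables (R : realType) (n : nat).
Implicit Types (S P F : set 'rV[R]_n) (c v x : 'rV[R]_n).

Lemma dotp_sumr c k (p : 'I_k -> 'rV[R]_n) (a : 'I_k -> R) :
  dotp c (\sum_i a i *: p i) = \sum_i a i * dotp c (p i).
Proof.
rewrite /dotp; under eq_bigr => j _ do rewrite summxE mulr_sumr.
rewrite exchange_big /=; apply: eq_bigr => i _; rewrite mulr_sumr.
by apply: eq_bigr => j _; rewrite mxE mulrCA.
Qed.

Lemma sub_conv_hull S : S `<=` conv_hull S.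
Proof.
move=> s Ss; exists 1%N, (fun=> s), (fun=> 1).
by split=> //; rewrite big_ord1 ?scale1r.
Qed.

Lemma weight_pos k (a : 'I_k -> R) : (forall i, 0 <= a i) -> \sum_i a i = 1 ->
  exists i, 0 < a i.
Proof.
move=> a0 a1; apply/not_existsP => aN.
have : \sum_i a i = 0.
  by apply: big1 => i _; apply/eqP; rewrite eq_le a0 andbT leNgt; apply/negP.
by rewrite a1 => /eqP; rewrite oner_eq0.
Qed.

Lemma conv_hull_nonempty S x : conv_hull S x -> exists s, S s.
Proof.
by move=> [k [p [a [Sp a0 a1 _]]]]; have [i _] := weight_pos a0 a1; exists (p i).
Qed.

Lemma dotp_conv_hull_le S c b x : (forall s, S s -> dotp c s <= b) ->
  conv_hull S x -> dotp c x <= b.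
Proof.
move=> Sb [k [p [a [Sp a0 a1 ->]]]]; rewrite dotp_sumr.
rewrite -[b]mul1r -a1 mulr_suml; apply: ler_sum => i _.
by rewrite ler_wpM2l ?Sb.
Qed.

(** A weighted mean of numbers at most [b] equals [b] only if every number of
    positive weight does, so the points off the hyperplane have weight zero. *)
Lemma conv_hull_support S c b x : (forall s, S s -> dotp c s <= b) ->
  conv_hull S x -> dotp c x = b -> conv_hull (S `&` [set s | dotp c s = b]) x.
Proof.
move=> Sb [k [p [a [Sp a0 a1 xE]]]] xb.
have pb i : 0 < a i -> dotp c (p i) = b.
  move=> ai; have : \sum_j a j * (b - dotp c (p j)) = 0.
    under eq_bigr do rewrite mulrBr.
    by rewrite sumrB -mulr_suml a1 mul1r -dotp_sumr -xE xb subrr.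
  move=> /eqP; rewrite psumr_eq0 => [/allP/(_ i)|j _]; last first.
    by rewrite mulr_ge0 // subr_ge0 Sb.
  by rewrite mem_index_enum mulf_eq0 gt_eqF //= subr_eq0 => /(_ isT)/eqP.
have [i0 ai0] := weight_pos a0 a1.
(* Points with coefficient zero may lie off the hyperplane; replace them. *)
exists k, (fun i => if 0 < a i then p i else p i0), a; split=> //.
  by move=> i; case: ifPn => ai; split; rewrite /= ?pb.
rewrite xE; apply: eq_bigr => i _; case: ifPn => //; rewrite -leNgt => ai.
have -> : a i = 0 by apply/eqP; rewrite eq_le ai a0.
by rewrite !scale0r.
Qed.

Lemma face_refl P : face P P.
Proof.
have d0 x : dotp 0 x = 0 by apply: big1 => i _; rewrite mxE mul0r.
exists 0, 0; split=> [x _|]; first by rewrite d0.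
by apply/seteqP; split=> [x Px|x []//]; split=> //=; exact: d0.
Qed.

(** A vertex of the face is exposed in two steps, first by the functional of
    the face and then by its own; in each step the points of [S] that attain the
    bound still have the vertex in their hull.  After the second step the only
    such point is the vertex itself. *)
Lemma vertices_face S F : face (conv_hull S) F -> vertices F `<=` S.
Proof.
move=> [c [b [cb FE]]] v [c' [b' [cb' vE]]].
have [Fv c'v] : (F `&` [set x | dotp c' x = b']) v by rewrite -vE.
have [Sv cv] : (conv_hull S `&` [set x | dotp c x = b]) v by rewrite -FE.
have Scb s : S s -> dotp c s <= b by move=> Ss; apply/cb/sub_conv_hull.
have SF s : (S `&` [set x | dotp c x = b]) s -> F s.
  by move=> [Ss cs]; rewrite FE; split=> //; apply: sub_conv_hull.
have SFb' s : (S `&` [set x | dotp c x = b]) s -> dotp c' s <= b'.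
  by move=> /SF/cb'.
have /conv_hull_nonempty[s [Ss c's]] :=
  conv_hull_support SFb' (conv_hull_support Scb Sv cv) c'v.
have : [set v] s by rewrite vE; split=> //; apply: SF.
by move=> <-; case: Ss.
Qed.

Lemma vertex_of_face P F v : face P F -> F v -> vertices P v -> vertices F v.
Proof.
move=> [c [b [_ FE]]] Fv [c' [b' [cb' vE]]].
have [_ c'v] : (P `&` [set x | dotp c' x = b']) v by rewrite -vE.
exists c', b'; split=> [x|]; first by rewrite FE => -[/cb'].
apply/seteqP; split=> [_ ->//|x []]; rewrite {1}FE => -[Px _] c'x.
by rewrite vE.
Qed.

End Hulls.

(** * Adjacent bases *)

Section BasisPolytope.
Variables (R : realType) (E : finType) (M : matroid E).
Implicit Types A B : {set E}.
Local Notation P := (basis_polytope R M).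

Lemma dotp_rho (c : 'rV[R]_#|E|) B :
  dotp c (rho R B) = \sum_(e in B) c 0 (enum_rank e).
Proof.
rewrite /dotp; under eq_bigr => i _ do rewrite /rho summxE mulr_sumr.
rewrite exchange_big /=; apply: eq_bigr => e _.
rewrite (bigD1 (enum_rank e)) //= mxE !eqxx mulr1 big1 ?addr0 // => i ie.
by rewrite mxE eqxx (negPf ie) mulr0.
Qed.

Lemma rhoE A e : rho R A 0 (enum_rank e) = (e \in A)%:R.
Proof.
rewrite /rho summxE; case: (boolP (e \in A)) => eA.
  rewrite (bigD1 e) //= mxE !eqxx big1 ?addr0 // => f /andP[_ fe].
  by rewrite mxE eqxx (inj_eq enum_rank_inj) eq_sym (negPf fe).
apply: big1 => f fA; rewrite mxE eqxx (inj_eq enum_rank_inj).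
by case: eqP => // ef; rewrite ef fA in eA.
Qed.

Lemma dotp_rho_rho A B : dotp (rho R A) (rho R B) = #|A :&: B|%:R.
Proof.
rewrite dotp_rho; under eq_bigr do rewrite rhoE.
rewrite -natr_sum -big_mkcondr /= sum1_card; congr (_%:R).
by apply: eq_card => e; rewrite !inE andbC.
Qed.

Lemma rho_basis_polytope B : B \in bases M -> P (rho R B).
Proof. by move=> Bb; apply: sub_conv_hull; exists B. Qed.

Lemma vertices_basis_polytope v : vertices P v ->
  exists2 B, B \in bases M & v = rho R B.
Proof. by move=> /(vertices_face (face_refl _))[B Bb <-]; exists B. Qed.

(** The functional [rho A] is at most [rank M] on all [rho B] and attains this
    value only for [B = A]; so [rho A] is a combination of no other bases. *)
Lemma rho_conv_hull_bases (S : set {set E}) A :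
  (forall B, S B -> B \in bases M) -> A \in bases M ->
  conv_hull [set rho R B | B in S] (rho R A) -> S A.
Proof.
move=> Sb Ab hullA.
have lt B : S B -> A != B -> dotp (rho R A) (rho R B) < (rank M)%:R.
  by move=> SB AB; rewrite dotp_rho_rho ltr_nat (card_basesI_lt Ab (Sb _ SB)).
have eqA : dotp (rho R A) (rho R A) = (rank M)%:R.
  by rewrite dotp_rho_rho finset.setIid (card_basis Ab).
have le z : [set rho R B | B in S] z -> dotp (rho R A) z <= (rank M)%:R.
  move=> [B SB <-]; have [->|/(lt _ SB)/ltW//] := eqVneq A B.
  by rewrite dotp_rho_rho finset.setIid (card_basis (Sb _ SB)).
have /conv_hull_nonempty[_ [[B SB <-] /= Bm]] := conv_hull_support le hullA eqA.
by have [->//|/(lt _ SB)] := eqVneq A B; rewrite Bm ltxx.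
Qed.

(** By minimality of [x], exchanging it for some [y] keeps [c] maximal; the new
    basis then lies on the edge, and as it contains [y] it must be [B]. *)
Lemma card_basesI_min_exchange (c : 'rV[R]_#|E|) b A B x :
  A \in bases M -> B \in bases M ->
  (forall z, P z -> dotp c z <= b) ->
  conv_hull [set rho R A; rho R B] = P `&` [set z | dotp c z = b] ->
  x \in (A :\: B)%SET ->
  (forall y, y \in (B :\: A)%SET ->
    c 0 (enum_rank x) <= c 0 (enum_rank y)) ->
  #|A :&: B|%SET.+1 = rank M.
Proof.
move=> Ab Bb cb edgeE xAB xmin.
have [y yBA A'b] := basis_exchange Ab Bb xAB.
set A' := (y |: A :\ x)%SET in A'b.
move: (xAB) (yBA); rewrite !inE => /andP[xB xA] /andP[yA yB].
have [_ cA] : (P `&` [set z | dotp c z = b]) (rho R A).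
  by rewrite -edgeE; apply: sub_conv_hull; left.
have cA' : dotp c (rho R A') = b.
  apply/eqP; rewrite eq_le (cb _ (rho_basis_polytope A'b)) /= -{1}cA !dotp_rho.
  rewrite (big_setD1 x xA) big_setU1 /= ?lerD2r ?xmin //.
  by rewrite !inE negb_and yA orbT.
have : conv_hull [set rho R D | D in [set A; B]] (rho R A').
  by rewrite image_setU !image_set1 edgeE; split=> //; exact: rho_basis_polytope.
move=> /rho_conv_hull_bases[D [->//|->//]|//|A'A|A'B].
  by move: yA; rewrite -A'A !inE eqxx.
suff -> : (A :&: B)%SET = (A :\ x)%SET.
  by rewrite -(card_basis Ab) (cardsD1 x A) xA.
apply/setP => e; rewrite -A'B !inE.
by have [->|] := eqVneq e y; rewrite ?(negPf yA) ?andbF //= andbCA andbb.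
Qed.

Lemma card_basesI_adj A B : A \in bases M -> B \in bases M ->
  sk_adj P (rho R A) (rho R B) -> #|A :&: B|%SET.+1 = rank M.
Proof.
move=> Ab Bb [_ _ nAB [[c [b [cb edgeE]]] _]].
have AB : A != B by apply: contra_notN nAB => /eqP->.
pose D := ((A :\: B) :|: (B :\: A))%SET.
have [x0 x0D] : exists x0, x0 \in D.
  apply/set0Pn; apply: contraNneq AB =>  D0.
  by rewrite finset.eqEsubset -!finset.setD_eq0 -finset.setU_eq0; apply/eqP.
have [x xD xmin] : exists2 x, x \in D &
    forall y, y \in D -> c 0 (enum_rank x) <= c 0 (enum_rank y).
  by case: (arg_minP (fun e => c 0 (enum_rank e)) x0D) => x; exists x.
move: xD; rewrite inE => /orP[xA|xB].
  apply: (card_basesI_min_exchange Ab Bb cb edgeE xA) => y yB.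
  by apply: xmin; rewrite inE yB orbT.
rewrite finset.setIC; rewrite classical_sets.setUC in edgeE.
apply: (card_basesI_min_exchange Bb Ab cb edgeE xB) => y yA.
by apply: xmin; rewrite inE yA.
Qed.

(** * The face spanned by a clique *)

Lemma dotp_sum_rho (K : {set {set E}}) B :
  dotp (\sum_(A in K) rho R A) (rho R B) = \sum_(A in K) #|A :&: B|%:R.
Proof.
rewrite dotp_rho; under eq_bigr do rewrite summxE.
rewrite exchange_big; apply: eq_bigr => A _.
by rewrite -dotp_rho dotp_rho_rho.
Qed.

Lemma dotp_sum_rho_mem (K : {set {set E}}) B :
  {in K, forall A, A \in bases M} ->
  {in K &, forall A B, A != B -> #|A :&: B|%SET.+1 = rank M} ->
  B \in K ->
  dotp (\sum_(A in K) rho R A) (rho R B) = 1 + ((rank M)%:R - 1) *+ #|K|.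
Proof.
move=> Kb Kadj BK; rewrite dotp_sum_rho (big_setD1 B) //=.
rewrite finset.setIid (card_basis (Kb _ BK)) (cardsD1 B K) BK mulrS addrA.
rewrite addrCA subrr addr0 -sumr_const; congr (_ + _); apply: eq_bigr => A.
rewrite !inE => /andP[AB AK].
by rewrite -(Kadj A B) // mulrSr addrK.
Qed.

Lemma dotp_sum_rho_notin (K : {set {set E}}) B :
  {in K, forall A, A \in bases M} -> B \in bases M -> B \notin K ->
  dotp (\sum_(A in K) rho R A) (rho R B) < 1 + ((rank M)%:R - 1) *+ #|K|.
Proof.
move=> Kb Bb BK; rewrite dotp_sum_rho -sumr_const ltr_pwDl ?ltr01 //.
apply: ler_sum => A AK; rewrite lerBrDr natr1 ler_nat.
by apply: card_basesI_lt (Kb _ AK) Bb _; apply: contraNneq BK => <-.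
Qed.

End BasisPolytope.

Theorem corollary4p9 (R : realType) (E : finType) (M : matroid E) :
  clique_face_property (basis_polytope R M).
Proof.
move=> C [CV Cadj]; pose P := basis_polytope R M.
pose K : {set {set E}} := [set B in bases M | `[< C (rho R B) >]]%SET.
have Kb : {in K, forall A, A \in bases M} by move=> A; rewrite inE => /andP[].
have KC A : A \in K -> C (rho R A) by rewrite inE => /andP[_ /asboolP].
have Kadj : {in K &, forall A B, A != B -> #|A :&: B|%SET.+1 = rank M}.
  move=> A B AK BK AB; apply: (@card_basesI_adj R); rewrite ?Kb //.
  apply: Cadj; [exact: KC|exact: KC|] => AeqB.
  have := card_basesI_lt (Kb _ AK) (Kb _ BK) AB.
  rewrite -(ltr_nat R) -dotp_rho_rho -AeqB dotp_rho_rho finset.setIid.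
  by rewrite (card_basis (Kb _ AK)) ltxx.
pose c : 'rV[R]_#|E| := \sum_(A in K) rho R A.
pose b : R := 1 + ((rank M)%:R - 1) *+ #|K|.
have cP x : P x -> dotp c x <= b.
  apply: dotp_conv_hull_le => _ [B /= Bb <-].
  have [BK|BK] := boolP (B \in K); first by rewrite (dotp_sum_rho_mem _ Kb).
  by apply/ltW/dotp_sum_rho_notin.
have Fface : face P (P `&` [set x | dotp c x = b]) by exists c, b.
exists (P `&` [set x | dotp c x = b]) => //; apply/seteqP; split=> v.
  move=> Cv; have [B Bb vE] := vertices_basis_polytope (CV _ Cv).
  apply: (vertex_of_face Fface _ (CV _ Cv)); rewrite vE.
  split; first exact: rho_basis_polytope.
  apply: (dotp_sum_rho_mem _ Kb Kadj).
  by rewrite inE Bb; apply/asboolP; rewrite -vE.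
move=> Fv; have [B /= Bb vE] := vertices_face Fface Fv.
rewrite -{v}vE in Fv *; apply: KC; apply: contraT => BK.
have [c' [b' [_ vE]]] := Fv.
have [[_ /= cv] _] : (P `&` [set x | dotp c x = b] `&`
    [set x | dotp c' x = b']) (rho R B) by rewrite -vE.
by have := dotp_sum_rho_notin R Kb Bb BK; rewrite -/c cv ltxx.
Qed.
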